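(* The theory $\mathbf{HA}^\omega + \mathbf{iRC!}_{\mathbf{N},\mathbf{N}} + \mathbf{LEM}$ derives the second-order comprehension principle $\mathbf{CA}$: for every formula $\phi(x)$ of the language of $\mathbf{HA}^\omega$, with $x$ of type $\mathbf{N}$ and $f$ not occurring free in $\phi$, $$\exists f^{\mathbf{N}\to\mathbf{N}}\ \forall x^{\mathbf{N}}\ \bigl(fx = 1 \Leftrightarrow \phi(x)\bigr).$$
   Context: Finite types: $\mathbf{N}$ is a finite type, and if $\sigma,\tau$ are finite types then so are $\sigma\to\tau$ and $\sigma\times\tau$. $\mathbf{HA}^\omega$ (Heyting arithmetic in all finite types) is the many-sorted intuitionistic first-order theory with countably many variables $x^\sigma,y^\sigma,\dots$ for each finite type $\sigma$, an equality predicate $=_\sigma$ for each type, application operators ($fx$ of type $\tau$ for $f$ of type $\sigma\to\tau$ and $x$ of type $\sigma$), and constants for zero, successor, recursors, pairing, projections, and the combinators $\mathbf{k}$ and $\mathbf{s}$. Its axioms are those of many-sorted intuitionistic predicate logic with equality, congruence rules for equality, the usual axioms for zero and successor, the induction scheme for all formulas, and the defining equations of the constants. Logical implication is written $\supset$. $\exists! y^\tau\,\phi(x,y)$ abbreviates $\exists y^\tau\phi(x,y)\land\forall y_1^\tau\forall y_2^\tau(\phi(x,y_1)\land\phi(x,y_2)\supset y_1=_\tau y_2)$. $\mathbf{iRC!}_{\mathbf{N},\mathbf{N}}$ (internal number-theoretic rule of unique choice) is the rule: if $\forall x^{\mathbf{N}}\exists! y^{\mathbf{N}}\,\phi(x,y)$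 is derivable, then $\exists f^{\mathbf{N}\to\mathbf{N}}\forall x^{\mathbf{N}}\,\phi(x,fx)$ is derivable. In an extension of $\mathbf{HA}^\omega$ by this rule and further axioms, the rule applies to everything derivable in the extended theory. $\mathbf{LEM}$ is the scheme $\phi\lor\neg\phi$ for all formulas $\phi$. *)

(* Defs.v *)
From Stdlib Require Import List.
Import ListNotations.

Inductive type : Type :=
| N : type
| Arr : type -> type -> type
| Prd : type -> type -> type.

Declare Scope type_scope_w.
Delimit Scope type_scope_w with ty.
Bind Scope type_scope_w with type.
Notation "s ⇒ t" := (Arr s t) (at level 55, right associativity) : type_scope_w.
Notation "s × t" := (Prd s t) (at level 45, right associativity) : type_scope_w.
Open Scope type_scope_w.

(* Syntax is intrinsically typed, with de Bruijn variables: a context lists the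
   types of the free variables that may occur, the most recently bound first.
   The countably many variables of each type are obtained by letting the
   context range over all lists of types. *)
Definition ctx : Type := list type.

Inductive var : ctx -> type -> Type :=
| vz {G : ctx} {s : type} : var (s :: G) s
| vs {G : ctx} {s t : type} : var G t -> var (s :: G) t.

Inductive term (G : ctx) : type -> Type :=
| Var {s : type} : var G s -> term G s
| App {s t : type} : term G (s ⇒ t) -> term G s -> term G t
| Zero : term G N
| Succ : term G (N ⇒ N)
| Rec (s : type) : term G (s ⇒ (N ⇒ s ⇒ s) ⇒ N ⇒ s)
| Pair (s t : type) : term G (s ⇒ t ⇒ s × t)
| Fst (s t : type) : term G (s × t ⇒ s)
| Snd (s t : type) : term G (s × t ⇒ t)
| CombK (s t : type) : term G (s ⇒ t ⇒ s)
| CombS (r s t : type) : term G ((r ⇒ s ⇒ t) ⇒ (r ⇒ s) ⇒ r ⇒ t).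

Arguments Var {G s} _.
Arguments App {G s t} _ _.
Arguments Zero {G}.
Arguments Succ {G}.
Arguments Rec {G} s.
Arguments Pair {G} s t.
Arguments Fst {G} s t.
Arguments Snd {G} s t.
Arguments CombK {G} s t.
Arguments CombS {G} r s t.

Inductive form (G : ctx) : Type :=
| Eq {s : type} : term G s -> term G s -> form G
| Bot : form G
| And : form G -> form G -> form G
| Or : form G -> form G -> form G
| Imp : form G -> form G -> form G
| All (s : type) : form (s :: G) -> form G
| Ex (s : type) : form (s :: G) -> form G.

Arguments Eq {G s} _ _.
Arguments Bot {G}.
Arguments And {G} _ _.
Arguments Or {G} _ _.
Arguments Imp {G} _ _.
Arguments All {G} s _.
Arguments Ex {G} s _.

Declare Scope ha_scope.
Delimit Scope ha_scope with ha.
Bind Scope ha_scope with term form.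
Notation "t ⋅ u" := (App t u) (at level 40, left associativity) : ha_scope.
Notation "t == u" := (Eq t u) (at level 70) : ha_scope.
Notation "p &&& q" := (And p q) (at level 75, right associativity) : ha_scope.
Notation "p ||| q" := (Or p q) (at level 76, right associativity) : ha_scope.
Notation "p ⊃ q" := (Imp p q) (at level 77, right associativity) : ha_scope.
Open Scope ha_scope.

Definition One {G : ctx} : term G N := Succ ⋅ Zero.
Definition Neg {G : ctx} (p : form G) : form G := p ⊃ Bot.
Definition Iff {G : ctx} (p q : form G) : form G := (p ⊃ q) &&& (q ⊃ p).

Definition sub (G H : ctx) : Type := forall s : type, var G s -> term H s.

(* Send the variable [vz] to [t] and the others according to [f]. *)
Definition scons {G H : ctx} {s : type} (t : term H s) (f : sub G H)
  : sub (s :: G) H :=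
  fun r x =>
    match x in var G' r'
      return match G' with
             | [] => unit
             | s' :: G'' => term H s' -> sub G'' H -> term H r'
             end
    with
    | vz => fun t _ => t
    | vs y => fun _ f => f _ y
    end t f.

Definition idsub {G : ctx} : sub G G := fun s x => Var x.
Definition shift {G : ctx} {s : type} : sub G (s :: G) := fun r x => Var (vs x).
Definition shift2 {G : ctx} {s t : type} : sub G (s :: t :: G) :=
  fun r x => Var (vs (vs x)).

Fixpoint sub_term {G H : ctx} {s : type} (f : sub G H) (t : term G s)
  : term H s :=
  match t in term _ r return term H r with
  | Var x => f _ x
  | App u v => App (sub_term f u) (sub_term f v)
  | Zero => Zero
  | Succ => Succ
  | Rec s => Rec s
  | Pair s t => Pair s t
  | Fst s t => Fst s t
  | Snd s t => Snd s t
  | CombK s t => CombK s t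
  | CombS r s t => CombS r s t
  end.

Definition up {G H : ctx} {s : type} (f : sub G H) : sub (s :: G) (s :: H) :=
  scons (Var vz) (fun r x => sub_term shift (f r x)).

Fixpoint sub_form {G H : ctx} (f : sub G H) (p : form G) : form H :=
  match p with
  | Eq t u => Eq (sub_term f t) (sub_term f u)
  | Bot => Bot
  | And p q => And (sub_form f p) (sub_form f q)
  | Or p q => Or (sub_form f p) (sub_form f q)
  | Imp p q => Imp (sub_form f p) (sub_form f q)
  | All s p => All s (sub_form (up f) p)
  | Ex s p => Ex s (sub_form (up f) p)
  end.

Definition inst {G : ctx} {s : type} (p : form (s :: G)) (t : term G s)
  : form G := sub_form (scons t idsub) p.
Definition weaken {G : ctx} {s : type} (p : form G) : form (s :: G) :=
  sub_form shift p.

(* [exists! y, p(y)]; under the two universal quantifiers the bound variables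
   are y1 = [vs vz] and y2 = [vz]. *)
Definition ExU {G : ctx} (t : type) (p : form (t :: G)) : form G :=
  Ex t p &&&
  All t (All t
    (sub_form (scons (Var (vs vz)) shift2) p &&& sub_form (scons (Var vz) shift2) p
       ⊃ Var (vs vz) == Var vz)).

(* Non-logical axioms. Equality at compound types is neither extensional nor
   reduced to equality at type N. Replacement of equals by equals in arbitrary
   terms and formulas follows from the instances below by induction on syntax. *)
Inductive ha_axiom (G : ctx) : form G -> Prop :=
| eq_refl_ax s (t : term G s) : ha_axiom G (t == t)
| eq_sym_ax s (t u : term G s) : ha_axiom G (t == u ⊃ u == t)
| eq_trans_ax s (t u v : term G s) :
    ha_axiom G (t == u ⊃ u == v ⊃ t == v)
| eq_app_ax s r (t u : term G (s ⇒ r)) (v w : term G s) :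
    ha_axiom G (t == u ⊃ v == w ⊃ t ⋅ v == u ⋅ w)
| succ_nonzero_ax (t : term G N) : ha_axiom G (Neg (Succ ⋅ t == Zero))
| succ_inj_ax (t u : term G N) :
    ha_axiom G (Succ ⋅ t == Succ ⋅ u ⊃ t == u)
| induction_ax (p : form (N :: G)) :
    ha_axiom G
      (inst p Zero ⊃
       All N (p ⊃ sub_form (scons (Succ ⋅ Var vz) shift) p) ⊃
       All N p)
| rec_zero_ax s (a : term G s) (b : term G (N ⇒ s ⇒ s)) :
    ha_axiom G (Rec s ⋅ a ⋅ b ⋅ Zero == a)
| rec_succ_ax s (a : term G s) (b : term G (N ⇒ s ⇒ s)) (n : term G N) :
    ha_axiom G (Rec s ⋅ a ⋅ b ⋅ (Succ ⋅ n) == b ⋅ n ⋅ (Rec s ⋅ a ⋅ b ⋅ n))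
| fst_ax s t (a : term G s) (b : term G t) :
    ha_axiom G (Fst s t ⋅ (Pair s t ⋅ a ⋅ b) == a)
| snd_ax s t (a : term G s) (b : term G t) :
    ha_axiom G (Snd s t ⋅ (Pair s t ⋅ a ⋅ b) == b)
| k_ax s t (a : term G s) (b : term G t) : ha_axiom G (CombK s t ⋅ a ⋅ b == a)
| s_ax r s t (a : term G (r ⇒ s ⇒ t)) (b : term G (r ⇒ s)) (c : term G r) :
    ha_axiom G (CombS r s t ⋅ a ⋅ b ⋅ c == a ⋅ c ⋅ (b ⋅ c)).

(* [derivable Ax Ru G D p]: p follows from the assumptions D, all with free
   variables in G, in the extension of intuitionistic HA^omega by the axioms Ax
   and by the one-premise rules Ru. The premise of such a rule has to be derived
   without assumptions (though it may contain free variables), and in that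
   derivation Ax and Ru are available again. *)
Inductive derivable
    (Ax : forall G : ctx, form G -> Prop)
    (Ru : forall G : ctx, form G -> form G -> Prop)
  : forall G : ctx, list (form G) -> form G -> Prop :=
| d_hyp G D p : In p D -> derivable Ax Ru G D p
| d_botE G D p : derivable Ax Ru G D Bot -> derivable Ax Ru G D p
| d_andI G D p q :
    derivable Ax Ru G D p -> derivable Ax Ru G D q ->
    derivable Ax Ru G D (p &&& q)
| d_andE1 G D p q : derivable Ax Ru G D (p &&& q) -> derivable Ax Ru G D p
| d_andE2 G D p q : derivable Ax Ru G D (p &&& q) -> derivable Ax Ru G D q
| d_orI1 G D p q : derivable Ax Ru G D p -> derivable Ax Ru G D (p ||| q)
| d_orI2 G D p q : derivable Ax Ru G D q -> derivable Ax Ru G D (p ||| q)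
| d_orE G D p q r :
    derivable Ax Ru G D (p ||| q) ->
    derivable Ax Ru G (p :: D) r -> derivable Ax Ru G (q :: D) r ->
    derivable Ax Ru G D r
| d_impI G D p q :
    derivable Ax Ru G (p :: D) q -> derivable Ax Ru G D (p ⊃ q)
| d_impE G D p q :
    derivable Ax Ru G D (p ⊃ q) -> derivable Ax Ru G D p ->
    derivable Ax Ru G D q
| d_allI G D s (p : form (s :: G)) :
    derivable Ax Ru (s :: G) (map weaken D) p -> derivable Ax Ru G D (All s p)
| d_allE G D s (p : form (s :: G)) (t : term G s) :
    derivable Ax Ru G D (All s p) -> derivable Ax Ru G D (inst p t)
| d_exI G D s (p : form (s :: G)) (t : term G s) :
    derivable Ax Ru G D (inst p t) -> derivable Ax Ru G D (Ex s p)
| d_exE G D s (p : form (s :: G)) q :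
    derivable Ax Ru G D (Ex s p) ->
    derivable Ax Ru (s :: G) (p :: map weaken D) (weaken q) ->
    derivable Ax Ru G D q
| d_ha G D p : ha_axiom G p -> derivable Ax Ru G D p
| d_axiom G D p : Ax G p -> derivable Ax Ru G D p
| d_rule G D p q :
    Ru G p q -> derivable Ax Ru G [] p -> derivable Ax Ru G D q.

Inductive LEM (G : ctx) : form G -> Prop :=
| lem (p : form G) : LEM G (p ||| Neg p).

(* In p(x,y), x = [vs vz] and y = [vz]; in the conclusion f = [vs vz] and
   x = [vz]. *)
Inductive iRC_NN (G : ctx) : form G -> form G -> Prop :=
| irc (p : form (N :: N :: G)) :
    iRC_NN G
      (All N (ExU N p))
      (Ex (N ⇒ N) (All N
        (sub_form (scons (Var (vs vz) ⋅ Var vz) (scons (Var vz) shift2)) p))).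

(* In the body f = [vs vz] and x = [vz]. The substitution renames the context of
   p past f, so that f does not occur free in p. *)
Definition CA {G : ctx} (p : form (N :: G)) : form G :=
  Ex (N ⇒ N) (All N
    (Iff (Var (vs vz) ⋅ Var vz == One)
         (sub_form (scons (Var vz) shift2) p))).

(* Main.v *)
From Stdlib Require Import List.
Import ListNotations.
Require Import Defs.

(** Classically, the relation "phi(x) and y = 1, or not phi(x) and y = 0" is
    functional: excluded middle yields a value y for every x. The rule of unique
    choice turns it into the characteristic function of phi, and [0 <> 1] gives
    the direction from fx = 1 to phi(x). *)

(** The non-variable index [s :: G] blocks plain case analysis, so the motive computes on the
    context and is trivial for [[]]. [P] is quantified inside it because its type mentions [s] and
    [G]. *)
Lemma var_cons_ind (G : ctx) (s : type) (P : forall r, var (s :: G) r -> Prop) :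
  P s vz -> (forall r (y : var G r), P r (vs y)) -> forall r x, P r x.
Proof.
  intros Hz Hs r x.
  refine (match x as x' in var G' r'
    return match G' return var G' r' -> Prop with
           | [] => fun _ => True
           | s' :: G'' => fun x' =>
               forall P : forall r, var (s' :: G'') r -> Prop,
               P s' vz -> (forall r y, P r (vs y)) -> P r' x'
           end x'
    with vz => _ | vs y => _ end P Hz Hs); auto.
Qed.

Definition comp {G H K : ctx} (f : sub H K) (g : sub G H) : sub G K :=
  fun s x => sub_term f (g s x).

Lemma sub_term_ext (G H : ctx) (s : type) (f g : sub G H) (t : term G s) :
  (forall r x, f r x = g r x) -> sub_term f t = sub_term g t.
Proof. intros E; induction t; simpl; congruence. Qed.

Lemma sub_term_id (G : ctx) (s : type) (t : term G s) : sub_term idsub t = t.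
Proof. induction t; simpl; unfold idsub in *; congruence. Qed.

Lemma sub_term_comp (G H K : ctx) (s : type) (f : sub H K) (g : sub G H)
  (t : term G s) : sub_term f (sub_term g t) = sub_term (comp f g) t.
Proof. induction t; simpl; unfold comp in *; congruence. Qed.

Lemma up_ext (G H : ctx) (s : type) (f g : sub G H) :
  (forall r x, f r x = g r x) -> forall r x, up (s := s) f r x = up g r x.
Proof.
  intros E; apply var_cons_ind; [reflexivity | intros r y; simpl].
  now rewrite E.
Qed.

Lemma up_id (G : ctx) (s r : type) (x : var (s :: G) r) :
  up idsub r x = idsub r x.
Proof. revert r x; apply var_cons_ind; reflexivity. Qed.

Lemma up_comp (G H K : ctx) (s : type) (f : sub H K) (g : sub G H) :
  forall r x, comp (up (s := s) f) (up g) r x = up (comp f g) r x.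
Proof.
  apply var_cons_ind; [reflexivity | intros r y].
  unfold comp; simpl; rewrite !sub_term_comp.
  now apply sub_term_ext.
Qed.

(** Substitutions are functions, so they are compared pointwise, without functional extensionality.
    They are quantified after [p] because each binder replaces them by their lifts under [up]. *)
Lemma sub_form_ext (G : ctx) (p : form G) :
  forall (H : ctx) (f g : sub G H),
  (forall r x, f r x = g r x) -> sub_form f p = sub_form g p.
Proof.
  induction p; intros H f g E; simpl; f_equal; auto using sub_term_ext, up_ext.
Qed.

Lemma sub_form_id (G : ctx) (p : form G) (f : sub G G) :
  (forall r x, f r x = Var x) -> sub_form f p = p.
Proof.
  intros E; rewrite (sub_form_ext _ p _ f idsub E); clear f E.
  induction p; simpl; f_equal; auto using sub_term_id;
    rewrite (sub_form_ext _ p _ _ idsub); auto using up_id.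
Qed.

Lemma sub_form_comp (G : ctx) (p : form G) :
  forall (H K : ctx) (f : sub H K) (g : sub G H),
  sub_form f (sub_form g p) = sub_form (comp f g) p.
Proof.
  induction p; intros H K f g; simpl; f_equal; auto using sub_term_comp;
    rewrite IHp; apply sub_form_ext, up_comp.
Qed.

Lemma sub_form_weaken (G H : ctx) (s : type) (p : form G) (t : term H s)
  (f : sub G H) : sub_form (scons t f) (weaken p) = sub_form f p.
Proof.
  unfold weaken; rewrite sub_form_comp.
  now apply sub_form_ext.
Qed.

Lemma inst_weaken (G : ctx) (s : type) (p : form G) (t : term G s) :
  inst (weaken p) t = p.
Proof. unfold inst; rewrite sub_form_weaken; now apply sub_form_id. Qed.

(** The renaming keeps [vz] and moves each [vs y] to [vs (vs y)]; the instantiation undoes the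
    latter. This lets an eigenvariable serve as the instance of a weakened quantified formula. *)
Lemma inst_up_shift (G : ctx) (s : type) (p : form (s :: G)) :
  inst (sub_form (up shift) p) (Var vz) = p.
Proof.
  unfold inst; rewrite sub_form_comp; apply sub_form_id.
  apply var_cons_ind; reflexivity.
Qed.

Section Derivations.

Variable Ax : forall G : ctx, form G -> Prop.
Variable Ru : forall G : ctx, form G -> form G -> Prop.

Lemma d_ex_mono (G : ctx) (D : list (form G)) (s : type) (p q : form (s :: G)) :
  derivable Ax Ru G D (Ex s p) ->
  derivable Ax Ru (s :: G) (p :: map weaken D) q ->
  derivable Ax Ru G D (Ex s q).
Proof.
  intros Hp Hq; apply d_exE with (1 := Hp); simpl.
  (* The witness for [q] is the eigenvariable that satisfies [p]. *)
  apply d_exI with (t := Var vz).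
  now rewrite inst_up_shift.
Qed.

Lemma d_all_mono (G : ctx) (D : list (form G)) (s : type) (p q : form (s :: G)) :
  In (All s p) D ->
  derivable Ax Ru (s :: G) (p :: map weaken D) q ->
  derivable Ax Ru G D (All s q).
Proof.
  intros Hp Hq; apply d_allI, d_impE with p; [now apply d_impI |].
  rewrite <- (inst_up_shift _ _ p).
  apply d_allE, d_hyp.
  exact (in_map weaken D (All s p) Hp).
Qed.

Lemma d_eq_sym (G : ctx) (D : list (form G)) (s : type) (t u : term G s) :
  derivable Ax Ru G D (t == u) -> derivable Ax Ru G D (u == t).
Proof. apply d_impE, d_ha, eq_sym_ax. Qed.

Lemma d_eq_trans (G : ctx) (D : list (form G)) (s : type) (t u v : term G s) :
  derivable Ax Ru G D (t == u) -> derivable Ax Ru G D (u == v) ->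
  derivable Ax Ru G D (t == v).
Proof.
  intros Htu; apply d_impE; revert Htu; apply d_impE, d_ha, eq_trans_ax.
Qed.

Lemma d_zero_one (G : ctx) (D : list (form G)) (t : term G N) (p : form G) :
  derivable Ax Ru G D (t == Zero) -> derivable Ax Ru G D (t == One) ->
  derivable Ax Ru G D p.
Proof.
  intros H0 H1; apply d_botE, d_impE with (One == Zero).
  - apply d_ha, succ_nonzero_ax.
  - apply d_eq_trans with t; [now apply d_eq_sym | exact H0].
Qed.

Lemma d_absurd (G : ctx) (D : list (form G)) (p q : form G) :
  derivable Ax Ru G D (Neg p) -> derivable Ax Ru G D p ->
  derivable Ax Ru G D q.
Proof. intros Hn Hp; apply d_botE, d_impE with p; assumption. Qed.

(** The graph of the characteristic function of [p]. Substitution passes through it by computation,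
    so [t] may become a constant, a variable or [f x]. *)
Definition char_value {G : ctx} (p : form G) (t : term G N) : form G :=
  (p &&& t == One) ||| (Neg p &&& t == Zero).

Ltac by_hyp :=
  solve [ apply d_hyp; simpl; auto
        | eapply d_andE1, d_hyp; simpl; auto
        | eapply d_andE2, d_hyp; simpl; auto ].

Lemma d_char_value_unique (G : ctx) (D : list (form G)) (p : form G)
  (t u : term G N) :
  derivable Ax Ru G D (char_value p t &&& char_value p u ⊃ t == u).
Proof.
  apply d_impI.
  apply d_orE with (p &&& t == One) (Neg p &&& t == Zero); [by_hyp | |];
    (* Of the four cases, the two mixed ones assume both [p] and [Neg p]; in the others [t] and [u]
       equal the same numeral. *)
    (apply d_orE with (p &&& u == One) (Neg p &&& u == Zero); [by_hyp | |]).
  - apply d_eq_trans with One; [| apply d_eq_sym]; by_hyp.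
  - apply d_absurd with p; by_hyp.
  - apply d_absurd with p; by_hyp.
  - apply d_eq_trans with Zero; [| apply d_eq_sym]; by_hyp.
Qed.

Lemma d_char_value_iff (G : ctx) (D : list (form G)) (p : form G)
  (t : term G N) :
  In (char_value p t) D -> derivable Ax Ru G D (Iff (t == One) p).
Proof.
  intros H.
  apply d_orE with (p &&& t == One) (Neg p &&& t == Zero);
    [now apply d_hyp | |]; apply d_andI; apply d_impI.
  - by_hyp.
  - by_hyp.
  (* In the case [Neg p], assuming [t == One] contradicts [t == Zero]. *)
  - apply d_zero_one with t; by_hyp.
  - apply d_absurd with p; by_hyp.
Qed.

Lemma d_char_value_ex (G : ctx) (D : list (form G)) (p : form G) :
  derivable Ax Ru G D (p ||| Neg p) ->
  derivable Ax Ru G D (Ex N (char_value (weaken p) (Var vz))).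
Proof.
  intros H; apply d_orE with (1 := H);
    [apply d_exI with One | apply d_exI with Zero];
    change (inst (char_value ?a ?b) ?t) with (char_value (inst a t) t);
    rewrite inst_weaken; [apply d_orI1 | apply d_orI2];
    apply d_andI; first [by_hyp | apply d_ha, eq_refl_ax].
Qed.

Lemma d_char_value_ExU (G : ctx) (D : list (form G)) (p : form G) :
  derivable Ax Ru G D (p ||| Neg p) ->
  derivable Ax Ru G D (ExU N (char_value (weaken p) (Var vz))).
Proof.
  intros H; apply d_andI; [now apply d_char_value_ex |].
  apply d_allI, d_allI.
  (* The two copies send [y] to [y1] and [y2]. Since [weaken p] does not contain [y], both leave the
     same formula, [p] renamed by [shift2], and uniqueness applies to it. *)
  change (sub_form ?f (char_value ?a ?b)) with
    (char_value (sub_form f a) (sub_term f b)).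
  rewrite !sub_form_weaken; apply d_char_value_unique.
Qed.

End Derivations.

Theorem proposition4p3 : forall (G : ctx) (p : form (cons N G)),
  derivable LEM iRC_NN G nil (CA p).
Proof.
  intros G p.
  (* The conclusion of the rule and [CA p] share the prefix over [f] and [x], so only their bodies
     need comparing. *)
  eapply d_ex_mono.
  - eapply d_rule; [apply irc with (p := char_value (weaken p) (Var vz)) |].
    (* The premise is derived without assumptions; excluded middle is used for [p] with [x] free. *)
    apply d_allI, d_char_value_ExU, d_axiom, lem.
  - eapply d_all_mono; [now left |].
    apply d_char_value_iff; left.
    (* Replacing [y] by [f x] affects only the value: [weaken p] discards it, which leaves exactly
       the renaming of [p] past [f] found in [CA]. *)
    change (sub_form ?f (char_value ?a ?b)) with
      (char_value (sub_form f a) (sub_term f b)).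
    now rewrite sub_form_weaken.
Qed.
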